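(* Let $\Lambda_\infty=(r_0=0,r_1,r_2,\dots)$ be strictly increasing with $\lim_{n\to\infty}r_n=\infty$ and $\sum_{i=1}^\infty 1/r_i=\infty$, and let $0<a<1$. For $m\ge1$ let $D_m=\{\eta_i(t^{r_1},\Lambda_m,[a,1])^{1/r_1}: i=0,\dots,m\}\subset[a,1]$. Then $D_m$ becomes dense in $[a,1]$ as $m\to\infty$, i.e. $$\lim_{m\to\infty}\ \sup_{x\in[a,1]}\ \min_{d\in D_m}|x-d|=0 .$$
   Context: For a sequence $0=r_0<r_1<r_2<\cdots$ of reals, write $\Lambda_n=(r_0,\dots,r_n)$ and $E(\Lambda_n)=\mathrm{span}(t^{r_0}=1,t^{r_1},\dots,t^{r_n})$ (functions on $]0,\infty[$). For an interval $[a,b]$ with $0<a<b$, the Chebyshev–Bernstein basis $(B^n_{0,\Lambda_n},\dots,B^n_{n,\Lambda_n})$ of $E(\Lambda_n)$ over $[a,b]$ is the unique basis of $E(\Lambda_n)$ with $\sum_{k=0}^n B^n_{k,\Lambda_n}\equiv 1$ such that, for each $k$, $B^n_{k,\Lambda_n}$ has a zero of multiplicity (exactly) $k$ at $a$ and of multiplicity $n-k$ at $b$. For $P\in E(\Lambda_n)$ and $m\ge n$, the control points $\eta_i(P,\Lambda_m,[a,b])$, $i=0,\dots,m$, are defined by $P(t)=\sum_{i=0}^m B^m_{i,\Lambda_m}(t)\,\eta_i(P,\Lambda_m,[a,b])$. *)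

(* Defs.v *)
From Stdlib Require Import Reals Lra Lia.
Open Scope R_scope.

Definition pw (r t : R) : R := Rpower t r.

Definition inE (r : nat -> R) (n : nat) (f : R -> R) : Prop :=
  exists c : nat -> R, forall t, 0 < t ->
    f t = sum_f_R0 (fun i => c i * pw (r i) t) n.

Definition derivs (f : R -> R) (fs : nat -> R -> R) : Prop :=
  (forall t, 0 < t -> fs O t = f t) /\
  (forall j t, 0 < t -> derivable_pt_lim (fs j) t (fs (S j) t)).

Definition zero_mult (f : R -> R) (x : R) (k : nat) : Prop :=
  exists fs, derivs f fs /\
    (forall j, (j < k)%nat -> fs j x = 0) /\ fs k x <> 0.

Definition is_CB_basis (r : nat -> R) (n : nat) (a b : R) (B : nat -> R -> R) : Prop :=
  (forall k, (k <= n)%nat -> inE r n (B k)) /\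
  (forall f, inE r n f -> exists c : nat -> R, forall t, 0 < t ->
       f t = sum_f_R0 (fun k => c k * B k t) n) /\
  (forall c : nat -> R, (forall t, 0 < t -> sum_f_R0 (fun k => c k * B k t) n = 0) ->
       forall k, (k <= n)%nat -> c k = 0) /\
  (forall t, 0 < t -> sum_f_R0 (fun k => B k t) n = 1) /\
  (forall k, (k <= n)%nat -> zero_mult (B k) a k /\ zero_mult (B k) b (n - k)).

Definition control_points (m : nat) (B : nat -> R -> R) (P : R -> R) (eta : nat -> R) : Prop :=
  forall t, 0 < t -> P t = sum_f_R0 (fun i => B i t * eta i) m.

(* Main.v *)
(* With x = ln t, elements of E(Lambda_n) are exponential sums and the interval is [ln a, 0].
   The operator f |-> f - t f' / r_(n+1) maps E(Lambda_(n+1)) to E(Lambda_n) and sends each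
   Chebyshev-Bernstein function to a combination of two adjacent ones of E(Lambda_n), with
   coefficients of known signs; hence the control points over [a, 1] lie in the convex hull
   of those over [0, 1], which for t^r are the products of (1 - r / r_k), j < k <= n.
   The divergence of the sum of 1 / r_k makes the control points of t^(r_1) and t^(r_q)
   over [0, 1] lie asymptotically above the curve (y, y^(r_q / r_1)), so the same holds over
   [a, 1]. The points (t^(r_1), t^(r_q)) are on that strictly convex curve and are averages,
   with weights B_i(t), of the control points over [a, 1]; this forces some control point
   of t^(r_1) to be close to t^(r_1). *)
Require Import Defs.
From Stdlib Require Import Reals Lra Lia Compare_dec Classical_Prop.
Open Scope R_scope.


(** * Exponential sums: derivatives, signs and zeros *)

Lemma sum_nonneg (f : nat -> R) n :
  (forall i, (i <= n)%nat -> 0 <= f i) -> 0 <= sum_f_R0 f n.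
Proof.
  induction n as [|n IH]; intros Hf; simpl; [now apply Hf|].
  apply Rplus_le_le_0_compat; [apply IH; intros; apply Hf; lia|now apply Hf].
Qed.

(** The derivative of order [s] in [x] of the sum of [c i * t ^ r i] at [t = exp x]. With the order
    as a parameter, zero multiplicities become statements about a single function. *)
Definition expsum (n : nat) (r c : nat -> R) (s : nat) (x : R) : R :=
  sum_f_R0 (fun i => c i * r i ^ s * exp (r i * x)) n.

Lemma sum_exchange (f : nat -> nat -> R) (n m : nat) :
  sum_f_R0 (fun i => sum_f_R0 (f i) m) n =
  sum_f_R0 (fun k => sum_f_R0 (fun i => f i k) n) m.
Proof.
  induction n as [|n IH]; simpl; [reflexivity|].
  now rewrite IH, <- sum_plus.
Qed.

Lemma sum_single (f : nat -> R) (n k : nat) :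
  (k <= n)%nat -> (forall i, (i <= n)%nat -> i <> k -> f i = 0) ->
  sum_f_R0 f n = f k.
Proof.
  induction n as [|n IH]; intros Hk Hf; simpl.
  - now replace k with 0%nat by lia.
  - destruct (Nat.eq_dec k (S n)) as [->|Hne].
    + rewrite sum_eq_R0; [lra|intros i Hi; apply Hf; lia].
    + rewrite IH; [rewrite (Hf (S n)); [lra|lia|lia]|lia|intros i Hi Hik; apply Hf; lia].
Qed.

Lemma expsum_ext n r c c' s x :
  (forall i, (i <= n)%nat -> c i = c' i) -> expsum n r c s x = expsum n r c' s x.
Proof. intros H; apply sum_eq; intros i Hi; now rewrite H. Qed.

Lemma expsum_comb n r m (d : nat -> R) (b : nat -> nat -> R) s x :
  expsum n r (fun i => sum_f_R0 (fun k => d k * b k i) m) s x =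
  sum_f_R0 (fun k => d k * expsum n r (b k) s x) m.
Proof.
  unfold expsum.
  rewrite (sum_eq _ (fun i => sum_f_R0 (fun k => d k * b k i * r i ^ s * exp (r i * x)) m)).
  - rewrite sum_exchange. apply sum_eq; intros k _.
    rewrite scal_sum. apply sum_eq; intros i _; ring.
  - intros i _. rewrite Rmult_assoc, Rmult_comm, scal_sum.
    apply sum_eq; intros k _; ring.
Qed.

Lemma expsum_reflect n r c s x :
  expsum n (fun i => - r i) c s x = (-1) ^ s * expsum n r c s (- x).
Proof.
  unfold expsum. rewrite scal_sum. apply sum_eq; intros i _.
  replace (- r i) with (-1 * r i) by ring. rewrite Rpow_mult_distr.
  replace (-1 * r i * x) with (r i * - x) by ring. ring.
Qed.

Lemma expsum_derive n r c s x :
  derivable_pt_lim (expsum n r c s) x (expsum n r c (S s) x).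
Proof.
  assert (Hterm : forall i, derivable_pt_lim (fun y => c i * r i ^ s * exp (r i * y)) x
                                    (c i * r i ^ S s * exp (r i * x))).
  { intros i.
    replace (c i * r i ^ S s * exp (r i * x))
      with (c i * r i ^ s * (exp (r i * x) * (r i * 1))) by (simpl; ring).
    apply (derivable_pt_lim_scal (fun y => exp (r i * y))).
    apply (derivable_pt_lim_comp (fun y => r i * y) exp).
    - apply derivable_pt_lim_scal, derivable_pt_lim_id.
    - apply derivable_pt_lim_exp. }
  unfold expsum. induction n as [|n IH]; simpl.
  - apply Hterm.
  - apply (derivable_pt_lim_plus
             (fun y => sum_f_R0 (fun i => c i * r i ^ s * exp (r i * y)) n)
             (fun y => c (S n) * r (S n) ^ s * exp (r (S n) * y))); auto.
Qed.

Lemma expsum_continuous n r c s : continuity (expsum n r c s).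
Proof.
  intros x. apply derivable_continuous_pt.
  eexists. apply expsum_derive.
Qed.

(** By the mean value theorem, positivity of one derivative just to the right of a zero passes to
    the derivative of the next lower order; iterate [k] times. *)
Lemma expsum_initial_sign n r c x0 : forall k s,
  (forall i, (i < k)%nat -> expsum n r c (s + i) x0 = 0) ->
  0 < expsum n r c (s + k) x0 ->
  exists delta, 0 < delta /\
    forall x, x0 < x < x0 + delta -> 0 < expsum n r c s x.
Proof.
  induction k as [|k IH]; intros s Hz Hpos.
  - rewrite Nat.add_0_r in Hpos.
    destruct (expsum_continuous n r c s x0 _ Hpos) as [delta [Hd H]].
    exists delta; split; [exact Hd|]; intros x Hx.
    assert (Hl : R_dist (expsum n r c s x) (expsum n r c s x0) < expsum n r c s x0).
    { apply H. split.
      - split; [exact I|lra].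
      - simpl. unfold Rdist. rewrite Rabs_right; lra. }
    unfold R_dist, Rdist in Hl. apply Rabs_def2 in Hl. lra.
  - destruct (IH (S s)) as [delta [Hd H]].
    + intros i Hi. replace (S s + i)%nat with (s + S i)%nat by lia. apply Hz; lia.
    + now replace (S s + k)%nat with (s + S k)%nat by lia.
    + exists delta; split; [exact Hd|]; intros x Hx.
      destruct (MVT_cor2 (expsum n r c s) (expsum n r c (S s)) x0 x) as [y [Hy Hxy]];
        [lra|intros; apply expsum_derive|].
      assert (expsum n r c s x0 = 0) as Hx0.
      { rewrite <- (Nat.add_0_r s). apply Hz; lia. }
      assert (0 < expsum n r c (S s) y) by (apply H; lra).
      assert (0 < expsum n r c (S s) y * (x - x0)) by (apply Rmult_lt_0_compat; lra).
      lra.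
Qed.

(** The operator [f' - r 0 * f] removes the lowest exponential, so it drives inductions on the
    number of terms. *)
Lemma expsum_reduce n r c s x :
  expsum n (fun i => r (S i)) (fun i => c (S i) * (r (S i) - r 0%nat)) s x =
  expsum (S n) r c (S s) x - r 0%nat * expsum (S n) r c s x.
Proof.
  unfold expsum. rewrite !(decomp_sum _ (S n)) by lia. simpl pred.
  assert (H : sum_f_R0 (fun i => c (S i) * r (S i) ^ S s * exp (r (S i) * x)) n =
    sum_f_R0 (fun i => c (S i) * (r (S i) - r 0%nat) * r (S i) ^ s * exp (r (S i) * x)) n
    + r 0%nat * sum_f_R0 (fun i => c (S i) * r (S i) ^ s * exp (r (S i) * x)) n).
  { rewrite (scal_sum _ _ (r 0%nat)), <- sum_plus. apply sum_eq; intros i _. simpl; ring. }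
  rewrite H. simpl. ring.
Qed.

(** Rolle's theorem for [exp (- rho * z) * f z]. *)
Lemma expsum_rolle n r c rho x y :
  x < y -> expsum n r c 0 x = 0 -> expsum n r c 0 y = 0 ->
  exists z, x < z < y /\ expsum n r c 1 z - rho * expsum n r c 0 z = 0.
Proof.
  intros Hxy Hx Hy.
  destruct (MVT_cor2 (fun z => exp (- rho * z) * expsum n r c 0 z)
     (fun z => exp (- rho * z) * (- rho * 1) * expsum n r c 0 z
               + exp (- rho * z) * expsum n r c 1 z) x y) as [z [Hz Hxz]]; [lra| |].
  - intros z _.
    apply (derivable_pt_lim_mult (fun z => exp (- rho * z)) (expsum n r c 0)).
    + apply (derivable_pt_lim_comp (fun y => - rho * y) exp).
      * apply derivable_pt_lim_scal, derivable_pt_lim_id.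
      * apply derivable_pt_lim_exp.
    + apply expsum_derive.
  - exists z; split; [exact Hxz|].
    rewrite Hx, Hy in Hz.
    apply Rmult_eq_reg_l with (exp (- rho * z) * (y - x)).
    + lra.
    + apply Rmult_integral_contrapositive. split; [|lra].
      apply Rgt_not_eq, exp_pos.
Qed.

Lemma finite_choice {T : Type} (P : nat -> T -> Prop) (k : nat) (z0 : T) :
  (forall i, (i < k)%nat -> exists z, P i z) ->
  exists f : nat -> T, forall i, (i < k)%nat -> P i (f i).
Proof.
  induction k as [|k IH]; intros H.
  - exists (fun _ => z0); intros; lia.
  - destruct IH as [f Hf]; [intros; apply H; lia|].
    destruct (H k) as [z Hz]; [lia|].
    exists (fun i => if Nat.eq_dec i k then z else f i); intros i Hi.
    destruct (Nat.eq_dec i k) as [->|]; [exact Hz|apply Hf; lia].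
Qed.

(** A nonzero sum of [n + 1] exponentials has at most [n] zeros, counting multiplicity at the two
    ends. Passing to [f' - r 0 * f] costs one exponential and one zero: each end loses one order,
    and Rolle gives a new zero between any two neighbouring zeros. *)
Lemma expsum_zeros : forall n r c al be j l k x,
  (forall i, (i < n)%nat -> r i < r (S i)) -> al < be ->
  (forall s, (s < j)%nat -> expsum n r c s al = 0) ->
  (forall s, (s < l)%nat -> expsum n r c s be = 0) ->
  (forall i, (i < k)%nat -> al < x i < be /\ expsum n r c 0 (x i) = 0) ->
  (forall i, (S i < k)%nat -> x i < x (S i)) ->
  (n < j + k + l)%nat ->
  forall i, (i <= n)%nat -> c i = 0.
Proof.
  induction n as [|n IH]; intros r c al be j l k x Hr Hab Hj Hl Hk Hx Hn;
    match goal with |- forall i, (i <= ?m)%nat -> _ =>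
      assert (Hz : exists z, expsum m r c 0 z = 0) by
        (destruct j; [destruct l; [exists (x 0%nat); apply Hk; lia
                                  |exists be; apply Hl; lia]|exists al; apply Hj; lia])
    end; destruct Hz as [z Hz].
  - intros i Hi. replace i with 0%nat by lia. unfold expsum in Hz; simpl in Hz.
    assert (0 < exp (r 0%nat * z)) by apply exp_pos. nra.
  (* [y] lists the distinct zeros in increasing order: [al] if [j > 0], then the [x i], then [be] if
     [l > 0]; [j1] and [l1] are 0 or 1 accordingly. *)
  - set (j1 := Nat.min j 1). set (l1 := Nat.min l 1).
    set (y := fun i => if lt_dec i j1 then al
                       else if lt_dec (i - j1) k then x (i - j1)%nat else be).
    assert (Hy : forall i, (i < j1 + k + l1)%nat -> expsum (S n) r c 0 (y i) = 0 /\ al <= y i <= be).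
    { intros i Hi. unfold y.
      destruct (lt_dec i j1); [|destruct (lt_dec (i - j1) k)].
      - split; [apply Hj; lia|lra].
      - destruct (Hk (i - j1)%nat); [lia|split; [assumption|lra]].
      - split; [apply Hl; lia|lra]. }
    assert (Hyy : forall i, (S i < j1 + k + l1)%nat -> y i < y (S i)).
    { intros i Hi. unfold y.
      destruct (lt_dec i j1); destruct (lt_dec (S i) j1); try lia.
      - destruct (lt_dec (S i - j1) k); [apply Hk; lia|lra].
      - destruct (lt_dec (i - j1) k); destruct (lt_dec (S i - j1) k); try lia.
        + replace (S i - j1)%nat with (S (i - j1)) by lia. apply Hx; lia.
        + apply Hk; lia. }
    destruct (finite_choice (fun i z => y i < z < y (S i) /\
        expsum (S n) r c 1 z - r 0%nat * expsum (S n) r c 0 z = 0) (j1 + k + l1 - 1) 0) as [w Hw].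
    { intros i Hi. apply expsum_rolle; [apply Hyy; lia|apply Hy; lia|apply Hy; lia]. }
    assert (Hc : forall i, (i <= n)%nat -> c (S i) * (r (S i) - r 0%nat) = 0).
    { intros i Hi.
      apply (IH (fun i => r (S i)) (fun i => c (S i) * (r (S i) - r 0%nat)) al be
               (j - 1)%nat (l - 1)%nat (j1 + k + l1 - 1)%nat w); try assumption.
      - intros; apply Hr; lia.
      - intros s Hs. rewrite expsum_reduce, !Hj by lia. ring.
      - intros s Hs. rewrite expsum_reduce, !Hl by lia. ring.
      - intros p Hp. rewrite expsum_reduce. destruct (Hw p Hp) as [H1 H2].
        destruct (Hy p); [lia|]. destruct (Hy (S p)); [lia|].
        split; [lra|assumption].
      - intros p Hp. destruct (Hw p); [lia|]. destruct (Hw (S p)); [lia|]. lra.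
      - lia. }
    assert (Hr0 : forall i, (i <= n)%nat -> r 0%nat < r (S i)).
    { induction i; intros Hi; [apply Hr; lia|].
      apply Rlt_trans with (r (S i)); [apply IHi; lia|apply Hr; lia]. }
    assert (Hc' : forall i, (i <= n)%nat -> c (S i) = 0).
    { intros i Hi. specialize (Hc i Hi). specialize (Hr0 i Hi).
      apply Rmult_integral in Hc. destruct Hc; [assumption|lra]. }
    intros [|i] Hi; [|apply Hc'; lia].
    unfold expsum in Hz. rewrite decomp_sum in Hz by lia.
    rewrite sum_eq_R0 in Hz.
    + simpl in Hz. assert (0 < exp (r 0%nat * z)) by apply exp_pos. nra.
    + intros p Hp. rewrite Hc' by (simpl in Hp; lia). ring.
Qed.


Lemma expsum_indep n r c :
  (forall i, (i < n)%nat -> r i < r (S i)) ->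
  (forall x, expsum n r c 0 x = 0) -> forall i, (i <= n)%nat -> c i = 0.
Proof.
  intros Hr H.
  apply (expsum_zeros n r c 0 (INR (n + 2)) 0 0 (n + 1) (fun i => INR (S i))); auto.
  - change 0 with (INR 0). apply lt_INR; lia.
  - intros; lia.
  - intros; lia.
  - intros i Hi. split; [|apply H]. split.
    + change 0 with (INR 0). apply lt_INR; lia.
    + apply lt_INR; lia.
  - intros i Hi. apply lt_INR; lia.
  - lia.
Qed.

Lemma expsum_opp n r c s x :
  expsum n r (fun i => - c i) s x = - expsum n r c s x.
Proof.
  replace (- expsum n r c s x) with (-1 * expsum n r c s x) by ring.
  unfold expsum. rewrite scal_sum. apply sum_eq; intros; ring.
Qed.

(** The two ends already use up all [n] zeros, so the sign is constant in between and is the one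
    given by the first surviving derivative at either end. *)
Lemma expsum_end_signs n r c al be k :
  (forall i, (i < n)%nat -> r i < r (S i)) -> al < be -> (k <= n)%nat ->
  (forall s, (s < k)%nat -> expsum n r c s al = 0) ->
  0 < expsum n r c k al ->
  (forall s, (s < n - k)%nat -> expsum n r c s be = 0) ->
  expsum n r c (n - k) be <> 0 ->
  (forall x, al < x < be -> 0 < expsum n r c 0 x) /\
  0 < (-1) ^ (n - k) * expsum n r c (n - k) be.
Proof.
  intros Hr Hab Hk Hl Hlp Hrz Hrne.
  assert (Hnz : forall x, al < x < be -> expsum n r c 0 x <> 0).
  { intros x Hx H0.
    assert (Hc : forall i, (i <= n)%nat -> c i = 0).
    { apply (expsum_zeros n r c al be k (n - k) 1 (fun _ => x)); auto; intros; lia. }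
    apply (Rlt_irrefl 0). rewrite <- (sum_eq_R0 (fun i => c i * r i ^ k * exp (r i * al)) n) at 2.
    - exact Hlp.
    - intros i Hi. rewrite Hc by lia. ring. }
  assert (Hpos : forall x, al < x < be -> 0 < expsum n r c 0 x).
  { intros x Hx.
    destruct (expsum_initial_sign n r c al k 0 Hl Hlp) as [delta [Hd H]].
    destruct (Rlt_or_le 0 (expsum n r c 0 x)) as [|Hle]; [assumption|exfalso].
    set (y := Rmin ((al + x) / 2) (al + delta / 2)).
    assert (Hy : al < y < x /\ y < al + delta).
    { unfold y, Rmin. destruct (Rle_dec ((al + x) / 2) (al + delta / 2)); lra. }
    assert (Hyp : 0 < expsum n r c 0 y) by (apply H; lra).
    destruct (IVT_cor (expsum n r c 0) y x) as [z [Hz Hz0]].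
    - apply expsum_continuous.
    - lra.
    - nra.
    - apply (Hnz z); [lra|assumption]. }
  split; [exact Hpos|].
  destruct (Rlt_or_le 0 ((-1) ^ (n - k) * expsum n r c (n - k) be)) as [|Hle]; [assumption|exfalso].
  assert (Hp1 : (-1) ^ (n - k) <> 0) by (apply pow_nonzero; lra).
  assert (Hlt : (-1) ^ (n - k) * expsum n r c (n - k) be < 0).
  { destruct Hle as [|He]; [assumption|]. apply Rmult_integral in He. tauto. }
  (* A wrong sign at [be] would make the negated, reflected sum positive just to the right of
     [- be], against the positivity of [f] to the left of [be]. *)
  assert (Hrefl : forall s x, expsum n (fun i => - r i) (fun i => - c i) s x
                    = - ((-1) ^ s * expsum n r c s (- x))).
  { intros. now rewrite expsum_opp, expsum_reflect. }
  destruct (expsum_initial_sign n (fun i => - r i) (fun i => - c i) (- be) (n - k) 0)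
    as [delta [Hd H]].
  - intros i Hi. simpl. rewrite Hrefl, Ropp_involutive, Hrz by lia. ring.
  - simpl. rewrite Hrefl, Ropp_involutive. lra.
  - set (y := Rmin ((be - al) / 2) (delta / 2)).
    assert (Hy : 0 < y < be - al /\ y < delta).
    { unfold y, Rmin. destruct (Rle_dec ((be - al) / 2) (delta / 2)); lra. }
    specialize (H (- be + y)). rewrite Hrefl in H. simpl in H.
    assert (0 < expsum n r c 0 (- (- be + y))) by (apply Hpos; lra).
    lra.
Qed.

(** * Coordinates in a Chebyshev-Bernstein basis *)

(** [M] is triangular once its rows are ordered by the position [pos k] of their first nonzero
    entry. In column [pos k], rows with smaller position drop out by induction and rows with larger
    position have entry zero. *)
Lemma triangular_kernel (M : nat -> nat -> R) (n p : nat) (d : nat -> R) (pos : nat -> nat) :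
  (forall k k', (k <= n)%nat -> (k' <= n)%nat -> pos k = pos k' -> k = k') ->
  (forall k s, (k <= n)%nat -> (s < pos k)%nat -> M k s = 0) ->
  (forall k, (k <= n)%nat -> M k (pos k) <> 0) ->
  (forall s, (s < p)%nat -> sum_f_R0 (fun k => d k * M k s) n = 0) ->
  forall k, (k <= n)%nat -> (pos k < p)%nat -> d k = 0.
Proof.
  intros Hinj Hlow Hdiag Hsum.
  assert (H : forall q k, (k <= n)%nat -> (pos k < q)%nat -> (pos k < p)%nat -> d k = 0).
  { induction q as [|q IH]; intros k Hk Hq Hp; [lia|].
    specialize (Hsum (pos k) Hp).
    rewrite (sum_single _ n k) in Hsum.
    - apply Rmult_integral in Hsum. destruct Hsum; [assumption|]. now destruct (Hdiag k Hk).
    - assumption.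
    - intros i Hi Hne.
      destruct (lt_eq_lt_dec (pos i) (pos k)) as [[Hlt|Heq]|Hgt].
      + rewrite (IH i); [ring|lia|lia|lia].
      + now destruct Hne; apply Hinj.
      + rewrite Hlow; [ring|lia|lia]. }
  intros k Hk Hp. now apply (H (S (pos k))); [|lia|].
Qed.

(* [b k i] is the coefficient of [exp (r i * x)] in the k-th element of the
   Chebyshev-Bernstein basis over [al, 0], after the substitution t = exp x. *)
Record cb_coeffs (r : nat -> R) (al : R) (n : nat) (b : nat -> nat -> R) : Prop := {
  cb_left0 : forall k s, (k <= n)%nat -> (s < k)%nat -> expsum n r (b k) s al = 0;
  cb_left : forall k, (k <= n)%nat -> expsum n r (b k) k al <> 0;
  cb_right0 : forall k s, (k <= n)%nat -> (s < n - k)%nat -> expsum n r (b k) s 0 = 0;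
  cb_right : forall k, (k <= n)%nat -> expsum n r (b k) (n - k) 0 <> 0;
  cb_span : forall c, exists d, forall i, (i <= n)%nat ->
      c i = sum_f_R0 (fun k => d k * b k i) n;
  cb_one : forall i, (i <= n)%nat ->
      sum_f_R0 (fun k => b k i) n = if Nat.eq_dec i 0 then 1 else 0
}.

Section Coordinates.
Context (r : nat -> R) (al : R) (n : nat) (b : nat -> nat -> R) (Hb : cb_coeffs r al n b).

(** The derivatives of the basis at [al] form a triangular matrix, so vanishing to order [p] there
    kills the first [p] coordinates. *)
Lemma cb_coord_left c d p :
  (forall i, (i <= n)%nat -> c i = sum_f_R0 (fun k => d k * b k i) n) ->
  (forall s, (s < p)%nat -> expsum n r c s al = 0) ->
  forall k, (k <= n)%nat -> (k < p)%nat -> d k = 0.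
Proof.
  intros Hc Hz.
  apply (triangular_kernel (fun k s => expsum n r (b k) s al) n p d (fun k => k)).
  - auto.
  - intros; now apply (cb_left0 _ _ _ _ Hb).
  - apply (cb_left _ _ _ _ Hb).
  - intros s Hs. rewrite <- expsum_comb, <- (expsum_ext _ _ c); auto.
Qed.

Lemma cb_coord_right c d q :
  (forall i, (i <= n)%nat -> c i = sum_f_R0 (fun k => d k * b k i) n) ->
  (forall s, (s < q)%nat -> expsum n r c s 0 = 0) ->
  forall k, (k <= n)%nat -> (n - k < q)%nat -> d k = 0.
Proof.
  intros Hc Hz.
  apply (triangular_kernel (fun k s => expsum n r (b k) s 0) n q d (fun k => (n - k)%nat)).
  - intros; lia.
  - intros; now apply (cb_right0 _ _ _ _ Hb).
  - apply (cb_right _ _ _ _ Hb).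
  - intros s Hs. rewrite <- expsum_comb, <- (expsum_ext _ _ c); auto.
Qed.

Lemma cb_coord_unique d d' :
  (forall i, (i <= n)%nat ->
     sum_f_R0 (fun k => d k * b k i) n = sum_f_R0 (fun k => d' k * b k i) n) ->
  forall k, (k <= n)%nat -> d k = d' k.
Proof.
  intros H k Hk. apply Rminus_diag_uniq.
  apply (cb_coord_left (fun _ => 0) (fun k => d k - d' k) (S n)); try lia.
  - intros i Hi. specialize (H i Hi).
    rewrite (sum_eq _ (fun k => d k * b k i - d' k * b k i)) by (intros; ring).
    rewrite minus_sum. lra.
  - intros s _. apply sum_eq_R0; intros; ring.
Qed.

End Coordinates.


(** * The lowering operator in terms of the bases of two consecutive spaces *)

Lemma sum_adjacent (f : nat -> R) (n j : nat) :
  (j <= S n)%nat -> (forall i, (i <= n)%nat -> i <> j -> S i <> j -> f i = 0) ->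
  sum_f_R0 f n = (if le_dec j n then f j else 0) + match j with O => 0 | S k => f k end.
Proof.
  revert j; induction n as [|n IH]; intros j Hj Hf; simpl.
  - destruct j as [|[|j]]; simpl; try lia; lra.
  - destruct (Nat.eq_dec j (S (S n))) as [->|Hne].
    + rewrite sum_eq_R0 by (intros i Hi; apply Hf; lia).
      destruct (le_dec (S (S n)) (S n)); [lia|lra].
    + rewrite (IH j) by (try lia; intros i Hi; apply Hf; lia).
      destruct (le_dec j n); destruct (le_dec j (S n)); try lia.
      * rewrite (Hf (S n)) by lia. lra.
      * replace j with (S n) by lia. lra.
Qed.

(* The coefficients of [f - f' / r (S n)], which annihilates [exp (r (S n) * x)]. *)
Definition lower (n : nat) (r c : nat -> R) (i : nat) : R := c i * (1 - r i / r (S n)).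

Lemma expsum_lower n r c s x : r (S n) <> 0 ->
  expsum n r (lower n r c) s x =
  expsum (S n) r c s x - expsum (S n) r c (S s) x / r (S n).
Proof.
  intros HR. unfold expsum. rewrite !tech5.
  assert (H : sum_f_R0 (fun i => lower n r c i * r i ^ s * exp (r i * x)) n =
     sum_f_R0 (fun i => c i * r i ^ s * exp (r i * x)) n -
     / r (S n) * sum_f_R0 (fun i => c i * r i ^ S s * exp (r i * x)) n).
  { rewrite scal_sum, <- minus_sum. apply sum_eq; intros i _.
    unfold lower. simpl. field. exact HR. }
  rewrite H. simpl. field. exact HR.
Qed.

Section Elevation.
Context (r : nat -> R) (r0 : r 0%nat = 0) (rinc : forall n, r n < r (S n)).
Context (al : R) (al0 : al < 0).

Lemma exponent_pos n : 0 < r (S n).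
Proof using r0 rinc.
  induction n as [|n IH]; [rewrite <- r0; apply rinc|].
  apply Rlt_trans with (r (S n)); auto.
Qed.

Section Step.
Context (n : nat) (b b' : nat -> nat -> R).
Context (Hb : cb_coeffs r al n b) (Hb' : cb_coeffs r al (S n) b').

(** [elevU] and [elevV] are the coefficients in [lower_basis], read off from the first surviving
    derivative: order [n - k] at 0 for [elevU k], order [k] at [al] for [elevV k]. *)
Definition elevU (k : nat) : R :=
  - expsum (S n) r (b' k) (S n - k) 0 / (r (S n) * expsum n r (b k) (n - k) 0).
Definition elevV (k : nat) : R :=
  - expsum (S n) r (b' (S k)) (S k) al / (r (S n) * expsum n r (b k) k al).

(** Since [f - f' / r (S n)] loses at most one order of vanishing at each end, only the coordinates
    [j - 1] and [j] survive. *)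
Lemma lower_basis j i : (j <= S n)%nat -> (i <= n)%nat ->
  lower n r (b' j) i =
  (if le_dec j n then elevU j * b j i else 0) +
  match j with O => 0 | S k => elevV k * b k i end.
Proof using r0 rinc Hb Hb'.
  intros Hj Hi. pose proof (exponent_pos n) as HR.
  destruct (cb_span _ _ _ _ Hb (lower n r (b' j))) as [d Hd].
  assert (HdL : forall k, (k <= n)%nat -> (S k < j)%nat -> d k = 0).
  { intros k Hk Hkj. apply (cb_coord_left r al n b Hb _ d (j - 1) Hd); try lia.
    intros s Hs. rewrite expsum_lower by lra.
    rewrite !(cb_left0 _ _ _ _ Hb') by lia. lra. }
  assert (HdR : forall k, (k <= n)%nat -> (j < k)%nat -> d k = 0).
  { intros k Hk Hkj. apply (cb_coord_right r al n b Hb _ d (n - j) Hd); try lia.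
    intros s Hs. rewrite expsum_lower by lra.
    rewrite !(cb_right0 _ _ _ _ Hb') by lia. lra. }
  assert (Hs : forall f : nat -> R, sum_f_R0 (fun k => d k * f k) n =
     (if le_dec j n then d j * f j else 0) + match j with O => 0 | S k => d k * f k end).
  { intros f. rewrite (sum_adjacent _ n j Hj); [reflexivity|].
    intros k Hk H1 H2. destruct (lt_dec k j); [rewrite HdL by lia|rewrite HdR by lia]; ring. }
  assert (He : forall s x, expsum (S n) r (b' j) s x - expsum (S n) r (b' j) (S s) x / r (S n) =
     (if le_dec j n then d j * expsum n r (b j) s x else 0)
     + match j with O => 0 | S k => d k * expsum n r (b k) s x end).
  { intros s x. rewrite <- expsum_lower by lra.
    rewrite (expsum_ext n r _ _ s x Hd), expsum_comb. apply Hs. }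
  rewrite (Hd i Hi), (Hs (fun k => b k i)). f_equal.
  - destruct (le_dec j n) as [Hjn|]; [f_equal|reflexivity].
    (* At 0 the derivative of order [n - j] still annihilates [b (j - 1)], which isolates [d j]. *)
    specialize (He (n - j)%nat 0).
    rewrite (cb_right0 _ _ _ _ Hb') in He by lia.
    replace (S (n - j)) with (S n - j)%nat in He by lia.
    assert (Hm : match j with O => 0 | S k => d k * expsum n r (b k) (n - j) 0 end = 0).
    { destruct j; [reflexivity|]. rewrite (cb_right0 _ _ _ _ Hb) by lia. ring. }
    rewrite Hm in He. pose proof (cb_right _ _ _ _ Hb j Hjn) as Hne.
    unfold elevU. apply (Rmult_eq_reg_r (expsum n r (b j) (n - j) 0)); [|exact Hne].
    replace (d j * expsum n r (b j) (n - j) 0)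
      with (0 - expsum (S n) r (b' j) (S n - j) 0 / r (S n)) by lra.
    field. split; lra.
  - destruct j as [|k]; [reflexivity|f_equal].
    (* At [al] the derivative of order [k] annihilates [b (S k)], which isolates [d k]. *)
    specialize (He k al). rewrite (cb_left0 _ _ _ _ Hb') in He by lia.
    assert (Hm : (if le_dec (S k) n then d (S k) * expsum n r (b (S k)) k al else 0) = 0).
    { destruct (le_dec (S k) n); [|reflexivity]. rewrite (cb_left0 _ _ _ _ Hb) by lia. ring. }
    rewrite Hm in He. assert (Hk : (k <= n)%nat) by lia.
    pose proof (cb_left _ _ _ _ Hb k Hk) as Hne.
    unfold elevV. apply (Rmult_eq_reg_r (expsum n r (b k) k al)); [|exact Hne].
    replace (d k * expsum n r (b k) k al)
      with (0 - expsum (S n) r (b' (S k)) (S k) al / r (S n)) by lra.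
    field. split; lra.
Qed.

Lemma lower_coords c d :
  (forall i, (i <= S n)%nat -> c i = sum_f_R0 (fun k => d k * b' k i) (S n)) ->
  forall i, (i <= n)%nat ->
  lower n r c i = sum_f_R0 (fun k => (elevU k * d k + elevV k * d (S k)) * b k i) n.
Proof using r0 rinc Hb Hb'.
  intros Hc i Hi. unfold lower. rewrite Hc by lia.
  rewrite Rmult_comm, scal_sum.
  rewrite (sum_eq _ (fun k => d k * (if le_dec k n then elevU k * b k i else 0) +
      d k * match k with O => 0 | S p => elevV p * b p i end)).
  - rewrite sum_plus, tech5, (decomp_sum (fun k => d k * match k with O => 0 | S p => elevV p * b p i end)) by lia.
    destruct (le_dec (S n) n) as [H|_]; [lia|].
    rewrite Rmult_0_r, Rplus_0_r, Rmult_0_r, Rplus_0_l. simpl pred.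
    rewrite <- sum_plus. apply sum_eq; intros k Hk.
    destruct (le_dec k n); [|lia]. ring.
  - intros k Hk. rewrite <- Rmult_plus_distr_l, <- lower_basis by assumption.
    unfold lower. ring.
Qed.

(** The constant 1 has all coordinates 1 in both bases and is fixed by the operator, because
    [r 0 = 0]. *)
Lemma elevUV_sum k : (k <= n)%nat -> elevU k + elevV k = 1.
Proof using r0 rinc Hb Hb'.
  revert k. apply (cb_coord_unique r al n b Hb).
  intros i Hi.
  rewrite (sum_eq _ (fun k => (elevU k * 1 + elevV k * 1) * b k i)) by (intros; ring).
  rewrite <- (lower_coords (fun i => if Nat.eq_dec i 0 then 1 else 0) (fun _ => 1)) by
    (try assumption; intros p Hp; rewrite <- (cb_one _ _ _ _ Hb' p Hp);
     apply sum_eq; intros; ring).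
  rewrite (sum_eq _ (fun k => b k i)) by (intros; ring).
  rewrite (cb_one _ _ _ _ Hb i Hi). unfold lower.
  destruct (Nat.eq_dec i 0) as [->|]; [rewrite r0; unfold Rdiv; ring|ring].
Qed.
End Step.

(** * Positivity of the bases, and comparison with the control points over [0, 1] *)

Definition cb_pos (n : nat) (b : nat -> nat -> R) : Prop :=
  forall k, (k <= n)%nat -> 0 < expsum n r (b k) k al.

Lemma cb_pos_signs n b : cb_coeffs r al n b -> cb_pos n b -> forall k, (k <= n)%nat ->
  (forall x, al < x < 0 -> 0 < expsum n r (b k) 0 x) /\
  0 < (-1) ^ (n - k) * expsum n r (b k) (n - k) 0.
Proof using rinc al0.
  intros Hb Hp k Hk.
  apply (expsum_end_signs n r (b k) al 0 k); auto.
  - intros s Hs. now apply (cb_left0 _ _ _ _ Hb).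
  - intros s Hs. now apply (cb_right0 _ _ _ _ Hb).
  - now apply (cb_right _ _ _ _ Hb).
Qed.

Lemma expsum_cb_one n b x : cb_coeffs r al n b ->
  sum_f_R0 (fun k => expsum n r (b k) 0 x) n = 1.
Proof using r0.
  intros Hb.
  rewrite (sum_eq _ (fun k => 1 * expsum n r (b k) 0 x)) by (intros; ring).
  rewrite <- expsum_comb. unfold expsum.
  rewrite (sum_single _ n 0).
  - rewrite (sum_eq _ (fun k => b k 0%nat)) by (intros; ring).
    rewrite (cb_one _ _ _ _ Hb) by lia. simpl. rewrite r0, Rmult_0_l, exp_0. ring.
  - lia.
  - intros i Hi Hne. rewrite (sum_eq _ (fun k => b k i)) by (intros; ring).
    rewrite (cb_one _ _ _ _ Hb) by lia. destruct (Nat.eq_dec i 0); [lia|ring].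
Qed.

Lemma expsum_cb_last n b : cb_coeffs r al n b -> expsum n r (b n) 0 0 = 1.
Proof using r0.
  intros Hb. rewrite <- (expsum_cb_one n b 0 Hb). symmetry.
  apply (sum_single (fun k => expsum n r (b k) 0 0)); [lia|].
  intros i Hi Hne. apply (cb_right0 _ _ _ _ Hb); lia.
Qed.

(** Downward induction on [k], from the last function, which equals 1 at 0. Positivity of [b' (S k)]
    makes [elevV k] negative, hence [elevU k = 1 - elevV k] positive; this gives the sign of [b' k]
    at 0, and [expsum_end_signs] carries it to [al]. *)
Lemma cb_pos_step n b b' :
  cb_coeffs r al n b -> cb_coeffs r al (S n) b' -> cb_pos n b -> cb_pos (S n) b'.
Proof using r0 rinc al0.
  intros Hb Hb' Hp.
  (* The sign is carried from 0 to [al] by contradiction, applying [expsum_end_signs] to the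
     opposite function. *)
  assert (Hsame : forall k, (k <= S n)%nat ->
     0 < (-1) ^ (S n - k) * expsum (S n) r (b' k) (S n - k) 0 ->
     0 < expsum (S n) r (b' k) k al).
  { intros k Hk Hpos. pose proof (cb_left _ _ _ _ Hb' k Hk) as Hne.
    destruct (Rlt_or_le 0 (expsum (S n) r (b' k) k al)) as [|Hle]; [assumption|exfalso].
    destruct (expsum_end_signs (S n) r (fun i => - b' k i) al 0 k) as [_ H]; auto.
    - intros s Hs. rewrite expsum_opp, (cb_left0 _ _ _ _ Hb') by lia. ring.
    - rewrite expsum_opp. lra.
    - intros s Hs. rewrite expsum_opp, (cb_right0 _ _ _ _ Hb') by lia. ring.
    - rewrite expsum_opp. pose proof (cb_right _ _ _ _ Hb' k Hk). lra.
    - rewrite expsum_opp in H. lra. }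
  assert (Hdown : forall p k, (k + p = S n)%nat -> 0 < expsum (S n) r (b' k) k al).
  { induction p as [|p IH]; intros k Hkp.
    - replace k with (S n) by lia. apply Hsame; [lia|].
      rewrite Nat.sub_diag, (expsum_cb_last _ _ Hb'). simpl; lra.
    - assert (Hk : (k <= n)%nat) by lia. apply Hsame; [lia|].
      pose proof (IH (S k) ltac:(lia)) as HV.
      pose proof (elevUV_sum n b b' Hb Hb' k Hk) as HUV.
      destruct (cb_pos_signs n b Hb Hp k Hk) as [_ Hs].
      pose proof (Hp k Hk) as Hl. pose proof (exponent_pos n) as HR.
      assert (HVneg : elevV n b b' k < 0).
      { unfold elevV, Rdiv. rewrite Ropp_mult_distr_l_reverse.
        apply Ropp_lt_gt_0_contravar, Rmult_lt_0_compat; [exact HV|].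
        apply Rinv_0_lt_compat, Rmult_lt_0_compat; assumption. }
      assert (HU : 0 < elevU n b b' k) by lra.
      replace (S n - k)%nat with (S (n - k)) in * by lia.
      assert (Heq : (-1) ^ S (n - k) * expsum (S n) r (b' k) (S (n - k)) 0 =
        elevU n b b' k * r (S n) * ((-1) ^ (n - k) * expsum n r (b k) (n - k) 0)).
      { unfold elevU. replace (S n - k)%nat with (S (n - k)) by lia. simpl. field.
        split; [|lra]. now apply (cb_right _ _ _ _ Hb). }
      rewrite Heq. apply Rmult_lt_0_compat; [|exact Hs].
      now apply Rmult_lt_0_compat. }
  intros k Hk. apply (Hdown (S n - k)%nat); lia.
Qed.

Lemma cb_pos_all : (forall n, exists b, cb_coeffs r al n b) ->
  forall n b, cb_coeffs r al n b -> cb_pos n b.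
Proof using r0 rinc al0.
  intros Hex n; induction n as [|n IH]; intros b Hb.
  - intros k Hk. replace k with 0%nat by lia.
    pose proof (cb_one _ _ _ _ Hb 0%nat (le_n 0)) as H1. simpl in H1.
    unfold expsum; simpl. rewrite H1. pose proof (exp_pos (r 0%nat * al)). lra.
  - destruct (Hex n) as [b0 Hb0]. apply (cb_pos_step n b0); auto.
Qed.

(* For exponents [r 0 < ... < r n] the numbers [gelfond r j n (r k)], j = 0..n, are the
   control points of [t ^ r k] on the limit interval [0, 1]. *)
Fixpoint gelfond (j n : nat) (x : R) : R :=
  match n with
  | O => 1
  | S p => if le_dec n j then 1 else (1 - x / r n) * gelfond j p x
  end.

Lemma gelfond_diag n x : gelfond n n x = 1.
Proof using. destruct n; simpl; [reflexivity|]. now destruct (le_dec (S n) (S n)); [|lia]. Qed.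

(** This is the convex hull property, tested on one functional at a time. Lowering multiplies [c k]
    by the last factor of [gelfond], so for [j <= n] the control points over [0, 1] are unchanged
    and the induction hypothesis gives [elevU k * d k + elevV k * d (S k) >= 0]. As
    [elevU k > 0 > elevV k], nonnegativity descends from [d (S n)]. *)
Lemma cb_coords_nonneg : (forall n, exists b, cb_coeffs r al n b) ->
  forall n b c d, cb_coeffs r al n b ->
  (forall i, (i <= n)%nat -> c i = sum_f_R0 (fun k => d k * b k i) n) ->
  (forall j, (j <= n)%nat -> 0 <= sum_f_R0 (fun k => c k * gelfond j n (r k)) n) ->
  forall i, (i <= n)%nat -> 0 <= d i.
Proof using r0 rinc al0.
  intros Hex n; induction n as [|n IH]; intros b c d Hb Hc Hg.
  - intros i Hi. replace i with 0%nat by lia.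
    specialize (Hg 0%nat (le_n 0)). simpl in Hg. rewrite (Hc 0%nat (le_n 0)) in Hg.
    pose proof (cb_one _ _ _ _ Hb 0%nat (le_n 0)) as H1. simpl in H1, Hg.
    rewrite H1 in Hg. lra.
  - destruct (Hex n) as [b0 Hb0].
    pose proof (cb_pos_all Hex n b0 Hb0) as Hp0.
    pose proof (cb_pos_all Hex (S n) b Hb) as Hp.
    pose proof (exponent_pos n) as HR.
    assert (Hlow : forall k, (k <= n)%nat -> 0 <= elevU n b0 b k * d k + elevV n b0 b k * d (S k)).
    { apply (IH b0 (lower n r c)).
      - exact Hb0.
      - intros i Hi. now apply lower_coords.
      - intros j Hj. specialize (Hg j ltac:(lia)). rewrite tech5 in Hg. simpl in Hg.
        destruct (le_dec (S n) j) as [|_]; [lia|].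
        replace (1 - r (S n) / r (S n)) with 0 in Hg by (field; lra).
        rewrite Rmult_0_l, Rmult_0_r, Rplus_0_r in Hg.
        rewrite (sum_eq _ (fun k => lower n r c k * gelfond j n (r k))) in Hg; [exact Hg|].
        intros i _. unfold lower. ring. }
    assert (Hdown : forall p k, (k + p = S n)%nat -> 0 <= d k).
    { induction p as [|p IHp]; intros k Hkp.
      (* For [j = S n] the hypothesis says that the function is nonnegative at [x = 0], where its
         value is its last coordinate. *)
      - replace k with (S n) by lia. specialize (Hg (S n) (le_n _)).
        rewrite (sum_eq _ (fun k => c k * r k ^ 0 * exp (r k * 0))) in Hg.
        + change (0 <= expsum (S n) r c 0 0) in Hg.
          rewrite (expsum_ext _ _ _ _ _ _ Hc), expsum_comb, (sum_single _ (S n) (S n)) in Hg.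
          * rewrite (expsum_cb_last _ _ Hb) in Hg. lra.
          * lia.
          * intros i Hi Hne. rewrite (cb_right0 _ _ _ _ Hb) by lia. ring.
        + intros i _. rewrite gelfond_diag, Rmult_0_r, exp_0. ring.
      - assert (Hk : (k <= n)%nat) by lia.
        pose proof (IHp (S k) ltac:(lia)) as Hd. specialize (Hlow k Hk).
        pose proof (elevUV_sum n b0 b Hb0 Hb k Hk) as HUV.
        assert (HV : elevV n b0 b k < 0).
        { unfold elevV, Rdiv. rewrite Ropp_mult_distr_l_reverse.
          apply Ropp_lt_gt_0_contravar, Rmult_lt_0_compat; [apply Hp; lia|].
          apply Rinv_0_lt_compat, Rmult_lt_0_compat; [exact HR|now apply Hp0]. }
        destruct (Rlt_or_le (d k) 0); [|assumption]. nra. }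
    intros i Hi. apply (Hdown (S n - i)%nat); lia.
Qed.
End Elevation.


(** * From power functions of [t] to exponential sums in [x = ln t] *)

Fixpoint falling (j : nat) (x : R) : R :=
  match j with O => 1 | S p => falling p x * (x - INR p) end.

(** The sequence [fs] is only assumed to consist of successive derivatives; uniqueness of
    derivatives on the positive axis identifies it. *)
Lemma derivs_powersum n r c f fs :
  (forall t, 0 < t -> f t = sum_f_R0 (fun i => c i * pw (r i) t) n) -> derivs f fs ->
  forall j t, 0 < t ->
  fs j t = sum_f_R0 (fun i => c i * falling j (r i) * Rpower t (r i - INR j)) n.
Proof.
  intros Hf [Hfs0 Hfs]; induction j as [|j IH]; intros t Ht.
  - rewrite Hfs0, Hf by assumption. apply sum_eq; intros i _.
    unfold pw. simpl. rewrite Rminus_0_r. ring.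
  - apply (uniqueness_limite (fs j) t); [now apply Hfs|].
    apply (derivable_pt_lim_locally_ext
      (fun t => sum_f_R0 (fun i => c i * falling j (r i) * Rpower t (r i - INR j)) n)
      _ t 0 (t + 1)); [lra|intros u Hu; symmetry; apply IH; lra|].
    clear - Ht.
    assert (Hterm : forall i, derivable_pt_lim
       (fun t => c i * falling j (r i) * Rpower t (r i - INR j)) t
       (c i * falling (S j) (r i) * Rpower t (r i - INR (S j)))).
    { intros i.
      replace (c i * falling (S j) (r i) * Rpower t (r i - INR (S j)))
        with (c i * falling j (r i) * ((r i - INR j) * Rpower t (r i - INR j - 1))).
      - apply (derivable_pt_lim_scal (fun t => Rpower t (r i - INR j))).
        now apply derivable_pt_lim_power.
      - rewrite S_INR. simpl falling.
        replace (r i - (INR j + 1)) with (r i - INR j - 1) by ring. ring. }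
    induction n as [|n IH]; simpl sum_f_R0; [apply Hterm|].
    apply (derivable_pt_lim_plus
      (fun t => sum_f_R0 (fun i => c i * falling j (r i) * Rpower t (r i - INR j)) n)); auto.
Qed.

(** The change of variable [t = exp x] preserves the multiplicity of a zero. *)
Lemma zero_mult_expsum n r c f t k : 0 < t ->
  (forall u, 0 < u -> f u = sum_f_R0 (fun i => c i * pw (r i) u) n) ->
  zero_mult f t k ->
  (forall s, (s < k)%nat -> expsum n r c s (ln t) = 0) /\ expsum n r c k (ln t) <> 0.
Proof.
  intros Ht Hf (fs & Hd & Hz & Hnz).
  (* [G d s] is the Euler operator [t d/dt] applied [d] times to [t ^ s] times the derivative of
     order [s] of [f]. The recursion [HGS] trades one Euler derivative for one ordinary derivative,
     up to a term that vanishes below order [k]. *)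
  set (G := fun d s => sum_f_R0 (fun i => c i * falling s (r i) * r i ^ d * exp (r i * ln t)) n).
  assert (HG : forall s, G 0%nat s = exp (INR s * ln t) * fs s t).
  { intros s. rewrite (derivs_powersum n r c f fs Hf Hd s t Ht), scal_sum.
    apply sum_eq; intros i _. unfold Rpower.
    replace (r i * ln t) with ((r i - INR s) * ln t + INR s * ln t) by ring.
    rewrite exp_plus. simpl. ring. }
  assert (HGS : forall d s, G (S d) s = G d (S s) + INR s * G d s).
  { intros d s. unfold G. rewrite (scal_sum _ n (INR s)), <- sum_plus.
    apply sum_eq; intros i _. simpl. ring. }
  assert (HGG : forall d s, (s + d <= k)%nat -> G d s = G 0%nat (s + d)%nat).
  { induction d as [|d IH]; intros s Hs; [now rewrite Nat.add_0_r|].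
    rewrite HGS, (IH s), (IH (S s)) by lia.
    rewrite (HG (s + d)%nat), Hz by lia.
    replace (s + S d)%nat with (S s + d)%nat by lia. ring. }
  assert (HE : forall s, (s <= k)%nat -> expsum n r c s (ln t) = exp (INR s * ln t) * fs s t).
  { intros s Hs. rewrite <- HG. change (G 0%nat s) with (G 0%nat (0 + s)%nat).
    rewrite <- HGG by lia.
    apply sum_eq; intros i _. simpl. ring. }
  split.
  - intros s Hs. rewrite HE, Hz by lia. ring.
  - rewrite HE by lia. apply Rmult_integral_contrapositive. split; [|exact Hnz].
    apply Rgt_not_eq, exp_pos.
Qed.

Lemma expsum_inj n r c c' :
  (forall i, (i < n)%nat -> r i < r (S i)) ->
  (forall x, expsum n r c 0 x = expsum n r c' 0 x) ->
  forall i, (i <= n)%nat -> c i = c' i.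
Proof.
  intros Hr H i Hi. apply Rminus_diag_uniq.
  apply (expsum_indep n r (fun i => c i - c' i) Hr); [|exact Hi].
  intros x. specialize (H x). unfold expsum in *.
  rewrite (sum_eq _ (fun i => c i * r i ^ 0 * exp (r i * x) - c' i * r i ^ 0 * exp (r i * x)))
    by (intros; ring).
  rewrite minus_sum. lra.
Qed.

(** The coefficients of [t ^ r p]. *)
Definition unit_vec (p i : nat) : R := if Nat.eq_dec i p then 1 else 0.

Lemma sum_unit_vec p n f : (p <= n)%nat -> sum_f_R0 (fun i => unit_vec p i * f i) n = f p.
Proof.
  intros Hp. rewrite (sum_single _ n p Hp); unfold unit_vec.
  - destruct (Nat.eq_dec p p); [ring|lia].
  - intros i _ Hi. destruct (Nat.eq_dec i p); [lia|ring].
Qed.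

Lemma expsum_unit_vec p n r x : (p <= n)%nat ->
  expsum n r (unit_vec p) 0 x = exp (r p * x).
Proof.
  intros Hp. rewrite <- (sum_unit_vec p n (fun i => exp (r i * x)) Hp).
  apply sum_eq; intros; simpl; ring.
Qed.

(** Spanning and partition of unity pass from functions to coefficients because the exponentials are
    linearly independent. *)
Lemma cb_coeffs_of_basis r n a B :
  r 0%nat = 0 -> (forall i, r i < r (S i)) -> 0 < a -> is_CB_basis r n a 1 B ->
  exists b, cb_coeffs r (ln a) n b /\
    forall k x, (k <= n)%nat -> B k (exp x) = expsum n r (b k) 0 x.
Proof.
  intros Hr0 Hr Ha (HE & Hspan & _ & Hone & Hmult).
  destruct (finite_choice (fun k (c : nat -> R) => forall t, 0 < t ->
     B k t = sum_f_R0 (fun i => c i * pw (r i) t) n) (S n) (fun _ => 0)) as [b Hb].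
  { intros k Hk. apply HE; lia. }
  assert (HBx : forall k x, (k <= n)%nat -> B k (exp x) = expsum n r (b k) 0 x).
  { intros k x Hk. rewrite Hb by (try lia; apply exp_pos).
    apply sum_eq; intros i _. unfold pw, Rpower. rewrite ln_exp. simpl; ring. }
  assert (Hz : forall k t p, (k <= n)%nat -> 0 < t -> zero_mult (B k) t p ->
     (forall s, (s < p)%nat -> expsum n r (b k) s (ln t) = 0) /\ expsum n r (b k) p (ln t) <> 0).
  { intros k t p Hk Ht. apply zero_mult_expsum; [exact Ht|]. intros; apply Hb; [lia|assumption]. }
  assert (Hl : forall k, (k <= n)%nat -> (forall s, (s < k)%nat -> expsum n r (b k) s (ln a) = 0)
     /\ expsum n r (b k) k (ln a) <> 0).
  { intros k Hk. apply Hz; [exact Hk|exact Ha|apply (Hmult k Hk)]. }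
  assert (Hrt : forall k, (k <= n)%nat -> (forall s, (s < n - k)%nat -> expsum n r (b k) s 0 = 0)
     /\ expsum n r (b k) (n - k) 0 <> 0).
  { intros k Hk. pose proof (Hz k 1 (n - k)%nat Hk Rlt_0_1 (proj2 (Hmult k Hk))) as H.
    rewrite ln_1 in H. exact H. }
  exists b; split; [constructor|exact HBx].
  - intros k s Hk. now apply Hl.
  - intros k Hk. now apply Hl.
  - intros k s Hk. now apply Hrt.
  - intros k Hk. now apply Hrt.
  - intros c. destruct (Hspan (fun t => sum_f_R0 (fun i => c i * pw (r i) t) n)) as [d Hd].
    { now exists c. }
    exists d. apply (expsum_inj n r); [auto|]. intros x.
    rewrite expsum_comb. specialize (Hd (exp x) (exp_pos x)).
    rewrite (sum_eq _ (fun k => d k * B k (exp x))) by (intros; now rewrite HBx).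
    rewrite <- Hd. apply sum_eq; intros i _. unfold pw, Rpower. rewrite ln_exp. simpl; ring.
  - change (forall i, (i <= n)%nat -> sum_f_R0 (fun k => b k i) n = unit_vec 0 i).
    apply (expsum_inj n r); [auto|]. intros x.
    rewrite expsum_unit_vec, Hr0, Rmult_0_l, exp_0 by lia.
    rewrite (expsum_ext n r _ (fun i => sum_f_R0 (fun k => 1 * b k i) n))
      by (intros i _; apply sum_eq; intros k _; symmetry; apply Rmult_1_l).
    rewrite expsum_comb. transitivity (sum_f_R0 (fun k => B k (exp x)) n);
      [|apply Hone, exp_pos].
    apply sum_eq; intros k Hk. rewrite HBx by assumption. ring.
Qed.

(** Bases are given for [m >= 1] only, while the inductions on the dimension start at 0. *)
Lemma cb_coeffs_0 r al : r 0%nat = 0 -> cb_coeffs r al 0 (fun _ => unit_vec 0).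
Proof.
  intros Hr0.
  assert (H1 : forall x, expsum 0 r (unit_vec 0) 0 x = 1).
  { intros x. rewrite expsum_unit_vec, Hr0, Rmult_0_l by lia. apply exp_0. }
  constructor; intros; simpl; try lia.
  - replace k with 0%nat by lia. rewrite H1. lra.
  - rewrite H1; lra.
  - exists c. intros i Hi. replace i with 0%nat by lia. unfold unit_vec; simpl. ring.
  - reflexivity.
Qed.


(** * A parabola below a power curve *)

(** Bernoulli's inequality with base [exp z]. From [exp ((s - 1) * z) >= 1 + (s - 1) * z] it reduces
    to [z * exp z >= exp z - 1], that is [exp (- z) >= 1 - z]. *)
Lemma exp_bernoulli s z : 1 <= s -> 1 + s * (exp z - 1) <= exp (s * z).
Proof.
  intros Hs.
  replace (s * z) with (z + (s - 1) * z) by ring. rewrite exp_plus.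
  pose proof (exp_ineq1_le ((s - 1) * z)) as H1.
  pose proof (exp_ineq1_le (- z)) as H2.
  pose proof (exp_pos z) as Hz.
  assert (H3 : exp z * exp (- z) = 1) by (rewrite <- exp_plus, Rplus_opp_r; apply exp_0).
  assert (H4 : 0 <= z * exp z - exp z + 1) by nra.
  assert (H5 : 0 <= (s - 1) * (z * exp z - exp z + 1)) by (apply Rmult_le_pos; lra).
  assert (H6 : exp z * (1 + (s - 1) * z) <= exp z * exp ((s - 1) * z))
    by (apply Rmult_le_compat_l; lra).
  lra.
Qed.

(* A parabola below [y |-> y ^ (p / s)] that touches it at [y = exp (s * z)]. *)
Definition parabola (s p z y : R) : R :=
  exp (p * z) + p / s * exp ((p - s) * z) * (y - exp (s * z)) +
  p / (2 * s) * exp ((p - 2 * s) * z) * (y - exp (s * z)) ^ 2.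

(** With [u = y / exp (s * z)] the parabola is [exp (p * z) * (1 + rho * (u ^ 2 - 1))], where
    [rho = p / (2 * s) >= 1]. It increases in [u >= 0], and Bernoulli's inequality for the base
    [exp (2 * w)] bounds it. *)
Lemma parabola_le s p z y X : 0 < s -> 2 * s <= p ->
  0 <= y <= exp (- s * X) -> parabola s p z y <= exp (- p * X).
Proof.
  intros Hs Hp [Hy0 Hy].
  set (u := y * exp (- s * z)).
  assert (Hrho : 1 <= p / (2 * s)).
  { apply (Rmult_le_reg_r (2 * s)); [lra|].
    replace (p / (2 * s) * (2 * s)) with p by (field; lra). lra. }
  assert (Hyu : y = u * exp (s * z)).
  { unfold u. rewrite Rmult_assoc, <- exp_plus.
    replace (- s * z + s * z) with 0 by ring. rewrite exp_0. ring. }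
  assert (Heq : parabola s p z y = exp (p * z) * (1 + p / (2 * s) * (u ^ 2 - 1))).
  { unfold parabola. rewrite Hyu.
    assert (E1 : exp ((p - s) * z) * exp (s * z) = exp (p * z))
      by (rewrite <- exp_plus; f_equal; ring).
    assert (E2 : exp ((p - 2 * s) * z) * (exp (s * z)) ^ 2 = exp (p * z)).
    { simpl. rewrite Rmult_1_r, <- !exp_plus. f_equal; ring. }
    replace (p / s * exp ((p - s) * z) * (u * exp (s * z) - exp (s * z)))
      with (p / s * (exp ((p - s) * z) * exp (s * z)) * (u - 1)) by ring.
    replace (p / (2 * s) * exp ((p - 2 * s) * z) * (u * exp (s * z) - exp (s * z)) ^ 2)
      with (p / (2 * s) * (exp ((p - 2 * s) * z) * exp (s * z) ^ 2) * (u - 1) ^ 2) by ring.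
    rewrite E1, E2. field. lra. }
  rewrite Heq.
  set (w := - s * X - s * z).
  assert (Hu : 0 <= u <= exp w).
  { unfold u, w. pose proof (exp_pos (- s * z)). split; [apply Rmult_le_pos; lra|].
    replace (- s * X - s * z) with (- s * X + - s * z) by ring. rewrite exp_plus.
    apply Rmult_le_compat_r; lra. }
  assert (Hu2 : u ^ 2 <= exp (2 * w)).
  { replace (2 * w) with (w + w) by ring. rewrite exp_plus. nra. }
  pose proof (exp_bernoulli (p / (2 * s)) (2 * w) Hrho) as Hb.
  assert (Hle : 1 + p / (2 * s) * (u ^ 2 - 1) <= exp (p / (2 * s) * (2 * w))) by nra.
  replace (exp (- p * X)) with (exp (p * z) * exp (p / (2 * s) * (2 * w))).
  - apply Rmult_le_compat_l; [left; apply exp_pos|exact Hle].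
  - rewrite <- exp_plus. f_equal. unfold w. field. lra.
Qed.

(** * Asymptotics of the control points over [0, 1] *)

Section Gelfond.
Context (r : nat -> R) (r0 : r 0%nat = 0) (rinc : forall n, r n < r (S n)).

Lemma exponent_mono i j : (i <= j)%nat -> r i <= r j.
Proof using rinc.
  induction 1 as [|j Hij IH]; [lra|]. specialize (rinc j). lra.
Qed.

Definition inv_sum (n : nat) : R :=
  match n with O => 0 | S p => sum_f_R0 (fun i => / r (S i)) p end.

Lemma inv_sum_S n : inv_sum (S n) = inv_sum n + / r (S n).
Proof using. destruct n; simpl; ring. Qed.

Lemma inv_sum_mono i j : (i <= j)%nat -> inv_sum i <= inv_sum j.
Proof using r0 rinc.
  induction 1 as [|j Hij IH]; [lra|]. rewrite inv_sum_S.
  pose proof (Rinv_0_lt_compat _ (exponent_pos r r0 rinc j)). lra.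
Qed.

Lemma gelfond_factor_range q n : (q <= S n)%nat -> 0 <= 1 - r q / r (S n) <= 1.
Proof using r0 rinc.
  intros Hq. pose proof (exponent_pos r r0 rinc n) as HR.
  pose proof (exponent_mono _ _ Hq). pose proof (exponent_mono 0 q (Nat.le_0_l q)).
  pose proof (Rinv_0_lt_compat _ HR).
  assert (r (S n) * / r (S n) = 1) by (field; lra).
  unfold Rdiv. split; nra.
Qed.

Lemma gelfond_range j m : 0 <= gelfond r j m (r 1%nat) <= 1.
Proof using r0 rinc.
  induction m as [|m IH]; simpl; [lra|].
  destruct (le_dec (S m) j); [lra|].
  pose proof (gelfond_factor_range 1 m ltac:(lia)). split; nra.
Qed.

(** Each factor satisfies [1 - u <= exp (- u)]. Only factors of index above [N] are kept, which
    gives one bound for all [j <= N]. *)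
Lemma gelfond_upper j N m : (j <= N)%nat ->
  gelfond r j m (r 1%nat) <= exp (- r 1%nat * (inv_sum m - inv_sum N)).
Proof using r0 rinc.
  intros HjN. pose proof (exponent_pos r r0 rinc 0) as H1.
  induction m as [|m IH].
  - pose proof (inv_sum_mono 0 N ltac:(lia)) as HN. simpl in *.
    pose proof (exp_ineq1_le (- r 1%nat * (0 - inv_sum N))). nra.
  - destruct (le_dec (S m) N) as [HmN|HmN].
    + pose proof (inv_sum_mono _ _ HmN). pose proof (gelfond_range j (S m)).
      pose proof (exp_ineq1_le (- r 1%nat * (inv_sum (S m) - inv_sum N))). nra.
    + rewrite inv_sum_S. simpl. destruct (le_dec (S m) j); [lia|].
      replace (- r 1%nat * (inv_sum m + / r (S m) - inv_sum N))
        with (- (r 1%nat / r (S m)) + - r 1%nat * (inv_sum m - inv_sum N))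
        by (unfold Rdiv; ring).
      rewrite exp_plus. pose proof (exp_ineq1_le (- (r 1%nat / r (S m)))).
      pose proof (gelfond_factor_range 1 m ltac:(lia)).
      pose proof (gelfond_range j m).
      apply Rmult_le_compat; lra.
Qed.

(** Factors of index below [q] are negative, but when one occurs so does the factor of index [q],
    which is zero. *)
Lemma gelfond_node_nonneg j m q : (1 <= q <= m)%nat -> 0 <= gelfond r j m (r q).
Proof using r0 rinc.
  intros [Hq Hqm]. induction m as [|m IH]; [lia|]. simpl.
  destruct (le_dec (S m) j); [lra|].
  destruct (Nat.eq_dec q (S m)) as [->|].
  - pose proof (exponent_pos r r0 rinc m).
    replace (1 - r (S m) / r (S m)) with 0 by (field; lra). lra.
  - apply Rmult_le_pos; [apply gelfond_factor_range; lia|apply IH; lia].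
Qed.

Lemma gelfond_lower eps x j m : 0 < eps -> 0 <= x ->
  (forall k, (j < k)%nat -> x / r k <= eps / (1 + eps)) -> (j <= m)%nat ->
  exp (- (x * (1 + eps)) * (inv_sum m - inv_sum j)) <= gelfond r j m x.
Proof using r0 rinc.
  intros Heps Hx Hsmall Hjm. induction Hjm as [|m Hjm IH].
  - rewrite gelfond_diag, Rminus_diag, Rmult_0_r, exp_0. lra.
  - simpl gelfond. destruct (le_dec (S m) j); [lia|].
    rewrite inv_sum_S. pose proof (exponent_pos r r0 rinc m) as HR.
    set (u := x / r (S m)).
    replace (- (x * (1 + eps)) * (inv_sum m + / r (S m) - inv_sum j))
      with (- (u * (1 + eps)) + - (x * (1 + eps)) * (inv_sum m - inv_sum j))
      by (unfold u, Rdiv; ring).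
    rewrite exp_plus.
    assert (Hu : 0 <= u).
    { unfold u, Rdiv. apply Rmult_le_pos; [lra|]. left; now apply Rinv_0_lt_compat. }
    assert (Hu2 : u * (1 + eps) <= eps).
    { apply (Rmult_le_reg_r (/ (1 + eps))); [apply Rinv_0_lt_compat; lra|].
      replace (u * (1 + eps) * / (1 + eps)) with u by (field; lra).
      apply Hsmall; lia. }
    assert (Hu1 : exp (- (u * (1 + eps))) <= 1 - u).
    { pose proof (exp_ineq1_le (u * (1 + eps))).
      pose proof (exp_pos (- (u * (1 + eps)))) as Hp.
      assert (He : exp (u * (1 + eps)) * exp (- (u * (1 + eps))) = 1)
        by (rewrite <- exp_plus, Rplus_opp_r; apply exp_0).
      (* The product minus 1 is [u * (eps - u * (1 + eps))], nonnegative by [Hu2]. *)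
      assert (Hv : 1 <= (1 - u) * (1 + u * (1 + eps))) by nra.
      assert (Hv2 : 0 < 1 - u) by nra.
      assert (Hv3 : 1 <= (1 - u) * exp (u * (1 + eps))) by nra.
      nra. }
    apply Rmult_le_compat; try (left; apply exp_pos); assumption.
Qed.

Lemma exp_scale_bound eps y : 0 < eps -> 0 <= y -> exp (- y) - eps <= exp (- (y * (1 + eps))).
Proof using.
  intros He Hy.
  replace (- (y * (1 + eps))) with (- y + - (eps * y)) by ring. rewrite exp_plus.
  pose proof (exp_ineq1_le (- (eps * y))) as H1. pose proof (exp_ineq1_le y) as H2.
  pose proof (exp_pos (- y)) as H3.
  assert (H4 : exp y * exp (- y) = 1) by (rewrite <- exp_plus, Rplus_opp_r; apply exp_0).
  assert (H5 : y * exp (- y) <= 1) by nra.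
  assert (H6 : exp (- y) * (1 + - (eps * y)) <= exp (- y) * exp (- (eps * y)))
    by (apply Rmult_le_compat_l; lra).
  nra.
Qed.

Context (rinf : cv_infty r) (rdiv : cv_infty (fun N => sum_f_R0 (fun i => / r (S i)) N)).

(** For [j > N] all ratios [r q / r k] are small and both products are close to exponentials of the
    same [X]. For [j <= N] divergence makes [X] so large that [exp (- r q * X) <= eps], and
    nonnegativity suffices. *)
Lemma gelfond_asymptotics q eps : (1 <= q)%nat -> 0 < eps ->
  exists M, (q <= M)%nat /\ forall m j, (M <= m)%nat -> (j <= m)%nat ->
  exists X, 0 <= gelfond r j m (r 1%nat) <= exp (- r 1%nat * X) /\
            exp (- r q * X) - eps <= gelfond r j m (r q).
Proof using r0 rinc rinf rdiv.
  intros Hq Heps.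
  assert (Hrq : 0 < r q) by (destruct q; [lia|now apply exponent_pos]).
  (* [N] ensures [r q / r k <= eps / (1 + eps)] for [k > N]; [M] below ensures [r q * X >= 1 / eps]
     when [j <= N]. *)
  destruct (rinf (r q * (1 + eps) / eps)) as [N HN].
  destruct (rdiv (inv_sum N + / (r q * eps))) as [M HM].
  exists (q + S M)%nat; split; [lia|]. intros m j Hm Hj.
  destruct (le_dec j N) as [HjN|HjN].
  - exists (inv_sum m - inv_sum N). split.
    + split; [apply gelfond_range|now apply gelfond_upper].
    + pose proof (gelfond_node_nonneg j m q ltac:(lia)).
      assert (Hbig : / eps <= r q * (inv_sum m - inv_sum N)).
      { destruct m as [|m]; [lia|]. specialize (HM m ltac:(lia)).
        change (sum_f_R0 (fun i => / r (S i)) m) with (inv_sum (S m)) in HM.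
        replace (/ eps) with (r q * / (r q * eps)) by (field; lra).
        apply Rmult_le_compat_l; lra. }
      set (w := r q * (inv_sum m - inv_sum N)) in *.
      replace (- r q * (inv_sum m - inv_sum N)) with (- w) by (unfold w; ring).
      pose proof (exp_ineq1_le w). pose proof (exp_pos (- w)).
      assert (He : exp w * exp (- w) = 1) by (rewrite <- exp_plus, Rplus_opp_r; apply exp_0).
      assert (Hie : eps * / eps = 1) by (field; lra).
      assert (Hw1 : 1 <= eps * exp w)
        by (rewrite <- Hie; apply Rmult_le_compat_l; lra).
      assert (Hw2 : exp (- w) * 1 <= exp (- w) * (eps * exp w))
        by (apply Rmult_le_compat_l; lra).
      nra.
  - exists (inv_sum m - inv_sum j). split.
    + split; [apply gelfond_range|now apply gelfond_upper].
    + apply Rle_trans with (exp (- (r q * (1 + eps)) * (inv_sum m - inv_sum j))).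
      * pose proof (inv_sum_mono _ _ Hj).
        replace (- r q * (inv_sum m - inv_sum j)) with (- (r q * (inv_sum m - inv_sum j))) by ring.
        replace (- (r q * (1 + eps)) * (inv_sum m - inv_sum j))
          with (- (r q * (inv_sum m - inv_sum j) * (1 + eps))) by ring.
        apply exp_scale_bound; [exact Heps|]. apply Rmult_le_pos; lra.
      * apply gelfond_lower; try lra; try lia.
        intros k Hk. specialize (HN k ltac:(lia)).
        assert (Hrk : 0 < r k) by (destruct k; [lia|now apply exponent_pos]).
        apply (Rmult_le_reg_r (r k * (1 + eps) / eps)).
        -- unfold Rdiv. apply Rmult_lt_0_compat; [nra|now apply Rinv_0_lt_compat].
        -- replace (r q / r k * (r k * (1 + eps) / eps)) with (r q * (1 + eps) / eps)
             by (field; lra).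
           replace (eps / (1 + eps) * (r k * (1 + eps) / eps)) with (r k) by (field; lra).
           lra.
Qed.
End Gelfond.


(** * Concentration of the control points over [a, 1] *)

Section Concentration.
Context (r : nat -> R) (r0 : r 0%nat = 0) (rinc : forall n, r n < r (S n)).
Context (al : R) (al0 : al < 0) (Hex : forall n, exists b, cb_coeffs r al n b).

Lemma cb_eval_nonneg n b k x : cb_coeffs r al n b -> (k <= n)%nat -> al <= x <= 0 ->
  0 <= expsum n r (b k) 0 x.
Proof using r0 rinc al0 Hex.
  intros Hb Hk Hx. pose proof (cb_pos_all r r0 rinc al al0 Hex n b Hb) as Hp.
  destruct (cb_pos_signs r rinc al al0 n b Hb Hp k Hk) as [Hin Hr].
  destruct (Req_dec x al) as [->|Hxa]; [|destruct (Req_dec x 0) as [->|Hx0]].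
  - destruct k as [|k]; [left; now apply Hp|].
    rewrite (cb_left0 _ _ _ _ Hb) by lia. lra.
  - destruct (Nat.eq_dec k n) as [->|Hkn].
    + rewrite Nat.sub_diag in Hr. simpl in Hr. lra.
    + rewrite (cb_right0 _ _ _ _ Hb) by lia. lra.
  - left; apply Hin; lra.
Qed.

(** The region above a convex parabola is an intersection of half-planes, so being above it, up to
    [eps], passes from the control points over [0, 1] to those over [a, 1] by [cb_coords_nonneg]. *)
Lemma parabola_control_points n b q eps z e1 e2 :
  (q <= n)%nat -> (1 <= n)%nat -> 2 * r 1%nat <= r q ->
  cb_coeffs r al n b ->
  (forall i, (i <= n)%nat -> unit_vec 1 i = sum_f_R0 (fun k => e1 k * b k i) n) ->
  (forall i, (i <= n)%nat -> unit_vec q i = sum_f_R0 (fun k => e2 k * b k i) n) ->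
  (forall j, (j <= n)%nat -> exists X,
     0 <= gelfond r j n (r 1%nat) <= exp (- r 1%nat * X) /\
     exp (- r q * X) - eps <= gelfond r j n (r q)) ->
  forall i, (i <= n)%nat -> parabola (r 1%nat) (r q) z (e1 i) - eps <= e2 i.
Proof using r0 rinc al0 Hex.
  intros Hqn Hn Hq Hb H1 Hq' Hg i Hi.
  set (s := r 1%nat) in *. set (y0 := exp (s * z)).
  assert (Hs : 0 < s) by now apply exponent_pos.
  set (L := r q / s * exp ((r q - s) * z)).
  set (K := r q / (2 * s) * exp ((r q - 2 * s) * z)).
  assert (HK : 0 <= K).
  { unfold K. apply Rmult_le_pos; [|left; apply exp_pos].
    unfold Rdiv. apply Rmult_le_pos; [lra|]. left; apply Rinv_0_lt_compat; lra. }
  assert (Hpar : forall y, parabola s (r q) z y = exp (r q * z) + L * (y - y0) + K * (y - y0) ^ 2)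
    by reflexivity.
  (* [sl] and [cst] describe the tangent to the parabola at [e1 i], lowered by [eps]; the claim is
     that the control point of index [i] lies above this line. *)
  set (sl := L + 2 * K * (e1 i - y0)).
  set (cst := parabola s (r q) z (e1 i) - eps - sl * e1 i).
  assert (H : 0 <= e2 i - sl * e1 i - cst); [|unfold cst in H; lra].
  set (c := fun p => unit_vec q p - sl * unit_vec 1 p - cst * unit_vec 0 p).
  assert (Hlin : forall (f g h : nat -> R) (m : nat),
     sum_f_R0 (fun k => f k - sl * g k - cst * h k) m =
     sum_f_R0 f m - sl * sum_f_R0 g m - cst * sum_f_R0 h m).
  { intros f g h m. rewrite !scal_sum, <- !minus_sum. apply sum_eq; intros; ring. }
  apply (cb_coords_nonneg r r0 rinc al al0 Hex n b c (fun k => e2 k - sl * e1 k - cst) Hb);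
    [| |exact Hi].
  - intros p Hp. unfold c. rewrite Hq', H1 by assumption.
    replace (unit_vec 0 p) with (sum_f_R0 (fun k => b k p) n)
      by (rewrite (cb_one _ _ _ _ Hb p Hp); reflexivity).
    rewrite <- Hlin. apply sum_eq; intros; ring.
  - intros j Hj.
    rewrite (sum_eq _ (fun k => unit_vec q k * gelfond r j n (r k)
       - sl * (unit_vec 1 k * gelfond r j n (r k)) - cst * (unit_vec 0 k * gelfond r j n (r k))))
      by (intros; unfold c; ring).
    rewrite Hlin, !(sum_unit_vec _ n (fun k => gelfond r j n (r k))) by lia.
    assert (Hg0 : gelfond r j n (r 0%nat) = 1).
    { rewrite r0. clear. induction n as [|n IH]; simpl; [reflexivity|].
      destruct (le_dec (S n) j); [reflexivity|]. rewrite IH. unfold Rdiv. ring. }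
    rewrite Hg0. destruct (Hg j Hj) as [X [HX1 HX2]].
    pose proof (parabola_le s (r q) z _ X Hs Hq HX1) as HX3.
    fold s. set (y := gelfond r j n s) in *.
    assert (Hconv : sl * y + cst + eps <= parabola s (r q) z y).
    { unfold cst, sl. rewrite !Hpar.
      pose proof (Rmult_le_pos K ((y - e1 i) ^ 2) HK (pow2_ge_0 _)). lra. }
    lra.
Qed.

(** Average the parabola inequality with the weights [w k], the basis values at [z]. The means of
    [e1] and [e2] are [exp (r 1 * z)] and [exp (r q * z)], so constant and linear terms cancel, and
    the quadratic term, at least [K * D], is at most [eps]. *)
Lemma concentration n b q eps z e1 D :
  (q <= n)%nat -> (1 <= n)%nat -> 2 * r 1%nat <= r q -> al <= z <= 0 ->
  cb_coeffs r al n b ->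
  (forall i, (i <= n)%nat -> unit_vec 1 i = sum_f_R0 (fun k => e1 k * b k i) n) ->
  (forall j, (j <= n)%nat -> exists X,
     0 <= gelfond r j n (r 1%nat) <= exp (- r 1%nat * X) /\
     exp (- r q * X) - eps <= gelfond r j n (r q)) ->
  (forall i, (i <= n)%nat -> D <= (e1 i - exp (r 1%nat * z)) ^ 2) ->
  r q / (2 * r 1%nat) * exp ((r q - 2 * r 1%nat) * z) * D <= eps.
Proof using r0 rinc al0 Hex.
  intros Hqn Hn Hq Hz Hb H1 Hg HD.
  destruct (cb_span _ _ _ _ Hb (unit_vec q)) as [e2 Hq'].
  pose proof (parabola_control_points n b q eps z e1 e2 Hqn Hn Hq Hb H1 Hq' Hg) as Hpar.
  assert (Hs : 0 < r 1%nat) by now apply exponent_pos.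
  set (L := r q / r 1%nat * exp ((r q - r 1%nat) * z)).
  set (K := r q / (2 * r 1%nat) * exp ((r q - 2 * r 1%nat) * z)).
  assert (HK : 0 <= K).
  { unfold K. apply Rmult_le_pos; [|left; apply exp_pos].
    unfold Rdiv. apply Rmult_le_pos; [lra|]. left; apply Rinv_0_lt_compat; lra. }
  set (w := fun k => expsum n r (b k) 0 z).
  assert (Hw : forall k, (k <= n)%nat -> 0 <= w k) by (intros; now apply cb_eval_nonneg).
  assert (Hmean : forall p e, (p <= n)%nat ->
     (forall i, (i <= n)%nat -> unit_vec p i = sum_f_R0 (fun k => e k * b k i) n) ->
     sum_f_R0 (fun k => e k * w k) n = exp (r p * z)).
  { intros p e Hp He. unfold w.
    now rewrite <- expsum_comb, <- (expsum_unit_vec p n r z Hp), <- (expsum_ext _ _ _ _ _ _ He). }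
  assert (Hone : sum_f_R0 w n = 1) by now apply (expsum_cb_one r r0 al).
  assert (Hsum : 0 <= sum_f_R0 (fun k => (e2 k * w k - L * (e1 k * w k)) -
      (exp (r q * z) - L * exp (r 1%nat * z) - eps + K * D) * w k) n).
  { apply sum_nonneg. intros k Hk. specialize (Hpar k Hk). specialize (HD k Hk).
    specialize (Hw k Hk). unfold parabola in Hpar. fold L K in Hpar.
    assert (HKD : K * D <= K * (e1 k - exp (r 1%nat * z)) ^ 2)
      by (apply Rmult_le_compat_l; assumption).
    replace (e2 k * w k - L * (e1 k * w k) -
      (exp (r q * z) - L * exp (r 1%nat * z) - eps + K * D) * w k)
      with ((e2 k - (exp (r q * z) + L * (e1 k - exp (r 1%nat * z)) + K * D - eps)) * w k) by ring.
    apply Rmult_le_pos; lra. }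
  rewrite minus_sum, minus_sum in Hsum.
  rewrite (Hmean q e2 Hqn Hq') in Hsum.
  rewrite (sum_eq (fun k => L * (e1 k * w k)) (fun k => e1 k * w k * L)),
    <- scal_sum, (Hmean 1%nat e1 Hn H1) in Hsum by (intros; ring).
  rewrite (sum_eq (fun k => _ * w k) (fun k => w k *
     (exp (r q * z) - L * exp (r 1%nat * z) - eps + K * D))), <- scal_sum, Hone in Hsum
    by (intros; ring).
  lra.
Qed.
End Concentration.

(** * Density: choice of the constants and conclusion *)

Theorem theorem8
  (r : nat -> R)
  (hr0 : r O = 0)
  (hinc : forall n, r n < r (S n))
  (hinf : cv_infty r)
  (hdiv : cv_infty (fun N => sum_f_R0 (fun i => / r (S i)) N))
  (a : R) (ha0 : 0 < a) (ha1 : a < 1)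
  (B : nat -> nat -> R -> R)
  (hB : forall m, (1 <= m)%nat -> is_CB_basis r m a 1 (B m))
  (eta : nat -> nat -> R)
  (heta : forall m, (1 <= m)%nat -> control_points m (B m) (pw (r 1%nat)) (eta m)) :
  forall eps, 0 < eps -> exists M : nat, forall m, (M <= m)%nat -> (1 <= m)%nat ->
    forall x, a <= x <= 1 ->
      exists i, (i <= m)%nat /\ Rabs (x - pw (/ r 1%nat) (eta m i)) < eps.
Proof.
  intros eps Heps.
  set (s := r 1%nat). assert (Hs : 0 < s) by now apply exponent_pos.
  set (al := ln a).
  assert (Hal : al < 0) by (unfold al; rewrite <- ln_1; now apply ln_increasing).
  assert (Hex : forall n, exists b, cb_coeffs r al n b).
  { intros [|n]; [eexists; now apply cb_coeffs_0|].
    destruct (cb_coeffs_of_basis r (S n) a (B (S n))) as [b [Hb _]]; auto.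
    - apply hB; lia.
    - now exists b. }
  destruct (hinf (2 * s)) as [q0 Hq0]. set (q := S q0).
  assert (Hq : 2 * s <= r q) by (left; apply Hq0; unfold q; lia).
  set (lo := exp (s * al)).
  assert (Hlo : 0 < lo) by apply exp_pos.
  (* Uniform continuity of the root is taken on an interval around [[lo, 1]], since control points
     within [d] of [exp (s * z)] may lie outside [[lo, 1]]; hence the bounds [lo / 2] and 1 in
     [d]. *)
  destruct (Heine (pw (/ s)) (fun c => lo / 2 <= c <= 2) (compact_P3 _ _)) with (mkposreal eps Heps)
    as [[delta Hdelta] Hunif].
  { intros c Hc. apply derivable_continuous_pt. eexists.
    apply derivable_pt_lim_power. lra. }
  simpl in Hunif.
  set (d := Rmin delta (Rmin (lo / 2) 1)).
  assert (Hd : 0 < d /\ d <= delta /\ d <= lo / 2 /\ d <= 1).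
  { unfold d, Rmin. destruct (Rle_dec (lo / 2) 1);
      [destruct (Rle_dec delta (lo / 2))|destruct (Rle_dec delta 1)]; lra. }
  (* The least quadratic coefficient of the parabolas for [z] in [[al, 0]], attained at [al] because
     [2 * s <= r q]. *)
  set (K0 := r q / (2 * s) * exp ((r q - 2 * s) * al)).
  assert (HK0 : 0 < K0).
  { unfold K0. apply Rmult_lt_0_compat; [|apply exp_pos].
    unfold Rdiv. apply Rmult_lt_0_compat; [lra|]. apply Rinv_0_lt_compat; lra. }
  assert (HKd : 0 < K0 * d ^ 2) by (apply Rmult_lt_0_compat; [lra|apply pow_lt; lra]).
  (* Half of [K0 * d ^ 2]: if every control point were at distance at least [d], [concentration]
     would give [K0 * d ^ 2 <= K0 * d ^ 2 / 2]. *)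
  destruct (gelfond_asymptotics r hr0 hinc hinf hdiv q (K0 * d ^ 2 / 2)) as [M [HqM HM]];
    [unfold q; lia|lra|].
  exists M. intros m Hm Hm1 x Hx.
  destruct (cb_coeffs_of_basis r m a (B m)) as [b [Hb HBb]]; auto.
  set (z := ln x).
  assert (Hxz : x = exp z) by (unfold z; rewrite exp_ln; lra).
  assert (Hz : al <= z <= 0).
  { rewrite Hxz in Hx. unfold al. split; apply Rnot_lt_le; intros Hlt;
      apply exp_increasing in Hlt; rewrite ?exp_0, ?exp_ln in Hlt; lra. }
  assert (He1 : forall i, (i <= m)%nat -> unit_vec 1 i = sum_f_R0 (fun k => eta m k * b k i) m).
  { apply (expsum_inj m r); [auto|]. intros u.
    rewrite expsum_comb, expsum_unit_vec by lia.
    pose proof (heta m Hm1 (exp u) (exp_pos u)) as Hu.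
    unfold pw, Rpower in Hu. rewrite ln_exp in Hu. rewrite Hu.
    apply sum_eq; intros k Hk. rewrite HBb by assumption. ring. }
  assert (Hnear : exists i, (i <= m)%nat /\ (eta m i - exp (s * z)) ^ 2 < d ^ 2).
  { apply NNPP; intros Hno.
    assert (Hfar : forall i, (i <= m)%nat -> d ^ 2 <= (eta m i - exp (s * z)) ^ 2).
    { intros i Hi. apply Rnot_lt_le; intros Hlt. apply Hno. now exists i. }
    pose proof (concentration r hr0 hinc al Hal Hex m b q (K0 * d ^ 2 / 2) z (eta m) (d ^ 2)
      ltac:(lia) Hm1 Hq Hz Hb He1 (fun j => HM m j Hm) Hfar) as Hc.
    fold s in Hc.
    assert (HK : K0 <= r q / (2 * s) * exp ((r q - 2 * s) * z)).
    { unfold K0. apply Rmult_le_compat_l.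
      - unfold Rdiv. apply Rmult_le_pos; [lra|]. left; apply Rinv_0_lt_compat; lra.
      - destruct (Rle_lt_or_eq_dec ((r q - 2 * s) * al) ((r q - 2 * s) * z)) as [Hl|Hl].
        + apply Rmult_le_compat_l; lra.
        + left; now apply exp_increasing.
        + rewrite Hl; lra. }
    pose proof (Rmult_le_compat_r (d ^ 2) _ _ (pow2_ge_0 d) HK). lra. }
  destruct Hnear as [i [Hi Hnear]].
  exists i; split; [exact Hi|].
  assert (Habs : Rabs (exp (s * z) - eta m i) < d).
  { rewrite <- (Rabs_pos_eq d) by lra. apply Rsqr_lt_abs_0. unfold Rsqr. lra. }
  assert (Hy : lo <= exp (s * z) <= 1).
  { unfold lo. rewrite <- exp_0. split.
    - destruct (Rle_lt_or_eq_dec (s * al) (s * z)) as [Hl|Hl];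
        [apply Rmult_le_compat_l; lra|left; now apply exp_increasing|rewrite Hl; lra].
    - destruct (Rle_lt_or_eq_dec (s * z) 0) as [Hl|Hl];
        [nra|left; now apply exp_increasing|rewrite Hl; lra]. }
  replace x with (pw (/ s) (exp (s * z))).
  - apply Rabs_def2 in Habs as Habs'. apply Hunif; lra.
  - unfold pw, Rpower. rewrite ln_exp, Hxz. f_equal. field. lra.
Qed.
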